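(* Let $m,j,k\in\mathbb{N}$ with $m\geq 4$, $1\leq j<\frac{m}{2}$, and $1\leq k\leq\frac{m}{2}$. The generalized Pappus graph $P(m,j,k)$ is 3-balanced if and only if $6\mid m$, $3\nmid j$, and $k=\frac{m}{2}$.
   Context: The generalized Pappus graph $P(m,j,k)$ is the simple graph with vertex set $\{v_i,u_i,w_i : i\in\mathbb{Z}_m\}$ and edges $v_iv_{i+1}$, $v_iu_i$, $u_iw_{i+j}$, $u_iw_{i-j}$, and $w_iw_{i+k}$ for $i\in\mathbb{Z}_m$. A graph is 3-balanced if it admits a vertex coloring $\ell:V\to\mathbb{Z}_3$ such that every vertex has, in its open neighborhood, the same number of vertices of each of the three colors. *)

(* Defs.v *)
From HB Require Import structures.
From mathcomp Require Import all_boot all_order all_algebra.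

Set Implicit Arguments.
Unset Strict Implicit.
Unset Printing Implicit Defensive.

Import GRing.Theory.
Local Open Scope ring_scope.

Record sgraph := SGraph {
  vertex :> finType;
  adj : rel vertex;
  adj_sym : symmetric adj;
  adj_irr : irreflexive adj
}.

Definition open_nbh (G : sgraph) (x : G) : {set G} := [set y | adj x y].

Definition three_balanced (G : sgraph) : Prop :=
  exists l : G -> 'Z_3, forall (x : G) (a b : 'Z_3),
    #|[set y in open_nbh x | l y == a]| = #|[set y in open_nbh x | l y == b]|.

Section GeneralizedPappus.

(* 'Z_m is the ring of integers modulo m only when 1 < m. *)
Variables m j k : nat.

Definition pvertex : finType := ('Z_m + 'Z_m + 'Z_m)%type.

Definition pv (i : 'Z_m) : pvertex := inl (inl i).
Definition pu (i : 'Z_m) : pvertex := inl (inr i).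
Definition pw (i : 'Z_m) : pvertex := inr i.

Definition pappus_arc (x y : pvertex) : bool :=
  [exists i : 'Z_m,
     [|| (x, y) == (pv i, pv (i + 1)),
         (x, y) == (pv i, pu i),
         (x, y) == (pu i, pw (i + j%:R)),
         (x, y) == (pu i, pw (i - j%:R))
       | (x, y) == (pw i, pw (i + k%:R))]].

(* The condition x != y only removes the would-be loops w_i w_(i+k) arising
   when k%:R = 0 in 'Z_m, so that the graph is simple for all parameters. *)
Definition pappus_adj (x y : pvertex) : bool :=
  (x != y) && (pappus_arc x y || pappus_arc y x).

Lemma pappus_adj_sym : symmetric pappus_adj.
Proof. by move=> x y; rewrite /pappus_adj eq_sym orbC. Qed.

Lemma pappus_adj_irr : irreflexive pappus_adj.
Proof. by move=> x; rewrite /pappus_adj eqxx. Qed.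

Definition pappus : sgraph := SGraph pappus_adj_sym pappus_adj_irr.

End GeneralizedPappus.

(* Main.v *)
Require Import Defs.
From HB Require Import structures.
From mathcomp Require Import all_boot all_order all_algebra all_field.
From mathcomp Require Import ring zify.

(* The vertex w_i has degree 4 unless k = m/2, so balance forces k = m/2 and
   every neighbourhood contains each colour exactly once.  Let a, b, c be 3
   times the indicator of one colour class on the v_i, u_i, w_i, minus 1.  At
   an m-th root of unity z with z^k = 1 the local conditions on the discrete
   Fourier transforms A, B, C of a, b, c eliminate to
     ((z^j + z^-j)^2 (z + z^-1) + 1) A(z) = 0.
   Let d be the 3-part of m.  If 3 | j or 3 does not divide m, the factor does
   not vanish when z^d = 1, so A vanishes at all d-th roots of unity; summing
   over them, the sum of a_i over the multiples i of d is 0, and this reads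
   3 N = m/d for a natural number N, which is absurd.
   Conversely, colour all of v_i, u_i, w_i by i mod 3. *)

Set Implicit Arguments.
Unset Strict Implicit.
Unset Printing Implicit Defensive.
Import Order.TTheory GRing.Theory Num.Theory.
Local Open Scope ring_scope.

(** * Cyclotomic divisibility and roots of unity of 3-power order *)

Local Notation pZtoC := (map_poly (intr : int -> algC)).

(** The remainder of [p] by [f] vanishes at [z] but has smaller degree than the minimal polynomial
    of [z], so it is 0. Dividing by a monic [f] keeps the quotient [r] integral, which allows
    reduction modulo 3 later. *)
Lemma monic_minpoly_factor n (z : algC) (f p : {poly int}) :
    n.-primitive_root z -> f \is monic -> size f = (totient n).+1 ->
    root (pZtoC f) z -> root (pZtoC p) z ->
  exists r, p = r * f.
Proof.
move=> zn f_mon sz_f fz pz; exists (Pdiv.Ring.rdivp p f).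
have def_p := Pdiv.RingMonic.rdivp_eq f_mon p.
suff r0: Pdiv.Ring.rmodp p f = 0 by rewrite {1}def_p r0 addr0.
have [//|r_n0] := eqVneq (Pdiv.Ring.rmodp p f) 0.
have rz: root (pZtoC (Pdiv.Ring.rmodp p f)) z.
  have := pz; rewrite {1}def_p rmorphD rmorphM /= /root hornerD hornerM.
  by rewrite (rootP fz) mulr0 add0r.
have [q [def_q q_mon] q_dv] := minCpolyP z.
have: q %| map_poly intr (Pdiv.Ring.rmodp p f).
  rewrite -q_dv -map_poly_comp.
  by rewrite (eq_map_poly (g := intr)) // => x /=; rewrite ratr_int.
move/dvdp_leq; rewrite map_poly_eq0_id0 ?intr_eq0 ?lead_coef_eq0 // => /(_ r_n0).
rewrite size_map_poly_id0 ?intr_eq0 ?lead_coef_eq0 //.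
have := Pdiv.Ring.ltn_rmodpN0 p (monic_neq0 f_mon).
have -> : size q = size f.
  by rewrite sz_f -(size_cyclotomic z) -(minCpoly_cyclotomic zn) def_q size_map_poly.
by rewrite ltnNge => /negP.
Qed.

(* z^(2j+1) ((z^j + z^-j)^2 (z + z^-1) + 1), as a polynomial in z. *)
Definition pappus_poly j : {poly int} :=
  ('X^(2 * j) + 1) ^+ 2 * ('X^2 + 1) + 'X^(2 * j + 1).

Lemma dvdp_Xn_sub_1 (F : fieldType) a b :
  (a %| b)%N -> ('X^a - 1 : {poly F}) %| 'X^b - 1.
Proof.
by move=> /dvdnP[c ->]; rewrite mulnC exprM (subrX1 'X^a) dvdp_mulIl.
Qed.

(* If z has order n = 3^(u+1) >= 9, then the n-th cyclotomic polynomial divides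
   pappus_poly j.  Modulo 3 it is (X^q - 1)^2 with q = 3^u, a multiple of
   X^3 - 1, whereas pappus_poly j is X^2 + X + 1 modulo 3 and X^3 - 1. *)
Lemma pappus_root_neq0 s j (z : algC) : z ^+ (3 ^ s) = 1 ->
    (0 < s -> 3 %| j)%N ->
  (z ^+ j + z ^- j) ^+ 2 * (z + z^-1) + 1 != 0.
Proof.
move=> zs dvj; apply/eqP => P0.
have z0: z != 0.
  by apply: contra_eq_neq zs => ->; rewrite expr0n expn_eq0 eq_sym oner_neq0.
have pz: root (pZtoC (pappus_poly j)) z.
  have zj0 : z ^+ j != 0 by rewrite expf_neq0.
  rewrite /root /pappus_poly !(rmorphD, rmorphM, rmorphXn, rmorph1, map_polyX) /=.
  rewrite map_polyX !hornerE.
  have -> : (z ^+ (2 * j) + 1) ^+ 2 * (z ^+ 2 + 1) + z ^+ (2 * j + 1) =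
      z * (z ^+ j) ^+ 2 * ((z ^+ j + z ^- j) ^+ 2 * (z + z^-1) + 1).
    rewrite exprD expr1 mulnC exprM; field; exact/andP.
  by rewrite P0 mulr0.
have [n zn] := prim_order_exists (expn_gt0 3 s : (0 < 3 ^ s)%N) zs.
case/(dvdn_pfactor _ _ (isT : prime 3)) => u us def_n.
case: u => [|u] in us def_n.
  (* Order 1: at [z = 1] the factor is 2^2 * 2 + 1 = 9. *)
  move: P0; have -> : z = 1 by rewrite -[z]expr1 -(prim_expr_order zn) def_n.
  rewrite !expr1n invr1; apply/eqP.
  have -> : (1 + 1) ^+ 2 * (1 + 1) + 1 = 9%:R :> algC by ring.
  by rewrite pnatr_eq0.
have {}dvj : (3 %| j)%N by apply: dvj; apply: leq_trans us.
pose q := (3 ^ u)%N.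
have q_gt0 : (0 < q)%N by rewrite expn_gt0.
(* [f] is the cyclotomic polynomial of order 3q: its degree 2q is [totient n], and [z ^+ q] is a
   primitive cube root of unity. *)
pose f : {poly int} := 'X^(q.*2) + ('X^q + 1).
have sz_Xq1 : size ('X^q + 1 : {poly int}) = q.+1.
  by rewrite size_polyDl size_polyXn // size_poly1 ltnS.
have lt_f : (size ('X^q + 1 : {poly int})%R < size ('X^(q.*2) : {poly int})%R)%N.
  by rewrite size_polyXn sz_Xq1 ltnS; lia.
have sz_f : size f = (totient n).+1.
  rewrite size_polyDl // size_polyXn def_n totient_pfactor //=.
  by rewrite mul2n.
have f_mon : f \is monic.
  by rewrite monicE lead_coefDl // lead_coefXn.
have y3 : (z ^+ q) ^+ 3 = 1 by rewrite -exprM -expnSr -def_n prim_expr_order.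
have y1 : z ^+ q != 1.
  rewrite -(prim_order_dvd zn) def_n; apply/negP => /dvdn_leq.
  by rewrite expn_gt0 => /(_ isT); rewrite leq_exp2l // ltnn.
have fz : root (pZtoC f) z.
  rewrite /root !(rmorphD, rmorphXn, rmorph1) /= !map_polyX !hornerE.
  have /mulfI yI : z ^+ q - 1 != 0 by rewrite subr_eq0.
  apply/eqP/yI; rewrite mulr0 -muln2 exprM.
  have -> : (z ^+ q - 1) * ((z ^+ q) ^+ 2 + z ^+ q + 1) = (z ^+ q) ^+ 3 - 1 by ring.
  by rewrite y3 subrr.
have [r def_p] := monic_minpoly_factor zn f_mon sz_f fz pz.
case: u us def_n @q q_gt0 @f sz_Xq1 lt_f sz_f f_mon y3 y1 fz def_p =>
  [|u] us def_n q q_gt0 f sz_Xq1 lt_f sz_f f_mon y3 y1 fz def_p.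
  (* Order 3 is done by hand, since for q = 1 the square (X^q - 1)^2 is no multiple of X^3 - 1. Here
     z^j = 1 and z + z^-1 = -1, so the factor is -3. *)
  case/dvdnP: dvj P0 => c ->; rewrite mulnC exprM.
  rewrite /q expn0 expr1 in y3 y1; rewrite y3 expr1n invr1 => P0.
  have z2: z ^+ 2 + z + 1 = 0.
    have /mulfI zI : z - 1 != 0 by rewrite subr_eq0.
    apply: zI; rewrite mulr0.
    have -> : (z - 1) * (z ^+ 2 + z + 1) = z ^+ 3 - 1 by ring.
    by rewrite y3 subrr.
  have : 3%:R * z == 0.
    have -> : 3%:R * z =
        4%:R * (z ^+ 2 + z + 1) - z * ((1 + 1) ^+ 2 * (z + z^-1) + 1) by field.
    by rewrite z2 P0 !mulr0 subrr.
  by rewrite mulf_eq0 pnatr_eq0 (negPf z0).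
pose M : {poly int} -> {poly 'F_3} := map_poly intr.
have three0: 3%:R = 0 :> {poly 'F_3}.
  by rewrite -polyC_natr; congr (_%:P); apply/val_inj.
pose g : {poly 'F_3} := 'X^3 - 1.
have gMf: g %| M f.
  have -> : M f = ('X^q - 1) ^+ 2 + 3%:R * 'X^q.
    rewrite /M /f !(rmorphD, rmorphXn, rmorph1) /= !map_polyX -muln2 exprM; ring.
  rewrite three0 mul0r addr0 expr2 dvdp_mulr // dvdp_Xn_sub_1 //.
  by rewrite /q expnS dvdn_mulr.
have : g %| M (pappus_poly j) by rewrite def_p /M rmorphM dvdp_mull.
(* Expansion around X^(2j) = 1, where the polynomial becomes 4(X^2 + 1) + X = (X^2 + X + 1) + 3(X^2
   + 1). *)
have -> : M (pappus_poly j) =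
    ('X^(2 * j) - 1) * (('X^(2 * j) + 3%:R) * ('X^2 + 1) + 'X) +
    ('X^2 + ('X + 1)) + 3%:R * ('X^2 + 1).
  rewrite /M /pappus_poly !(rmorphD, rmorphM, rmorphXn, rmorph1) /=.
  rewrite !map_polyX exprD expr1; ring.
rewrite three0 mul0r addr0 dvdp_addr; last first.
  by rewrite dvdp_mulr // dvdp_Xn_sub_1 // dvdn_mull.
have sz2: size ('X^2 + ('X + 1) : {poly 'F_3}) = 3.
  by rewrite size_polyDl size_polyXn // -polyC1 size_XaddC.
move/dvdp_leq; rewrite -size_poly_eq0 sz2 size_Xn_sub_1 //.
by move/(_ isT).
Qed.

Lemma natr_Zp_eq0 m n : (1 < m)%N -> (n%:R == 0 :> 'Z_m) = (m %| n)%N.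
Proof. by move=> m_gt1; rewrite -val_eqE /= val_Zp_nat. Qed.

(** * Arcs and open neighbourhoods *)

Section Neighbourhoods.

Variables m j k : nat.

Local Notation arc := (@pappus_arc m j k).

Lemma pappus_arc_v i y : arc (pv i) y = (y == pv (i + 1)) || (y == pu i).
Proof.
apply/existsP/orP => [[x]|[]/eqP->]; last 2 first.
- by exists i; rewrite eqxx.
- by exists i; rewrite eqxx !orbT.
by do 4?[case/orP]; move=> /eqP[] // <- ->; [left | right].
Qed.

Lemma pappus_arc_to_v i y : arc y (pv i) = (y == pv (i - 1)).
Proof.
apply/existsP/eqP => [[x]|->]; last by exists (i - 1); rewrite subrK eqxx.
by do 4?[case/orP]; move=> /eqP[] // -> ->; rewrite addrK.
Qed.

Lemma pappus_arc_u i y :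
  arc (pu i) y = (y == pw (i + j%:R)) || (y == pw (i - j%:R)).
Proof.
apply/existsP/orP => [[x]|[]/eqP->]; last 2 first.
- by exists i; rewrite eqxx !orbT.
- by exists i; rewrite eqxx !orbT.
by do 4?[case/orP]; move=> /eqP[] // <- ->; [left | right].
Qed.

Lemma pappus_arc_to_u i y : arc y (pu i) = (y == pv i).
Proof.
apply/existsP/eqP => [[x]|->]; last by exists i; rewrite eqxx orbT.
by do 4?[case/orP]; move=> /eqP[] // -> ->.
Qed.

Lemma pappus_arc_w i y : arc (pw i) y = (y == pw (i + k%:R)).
Proof.
apply/existsP/eqP => [[x]|->]; last by exists i; rewrite eqxx !orbT.
by do 4?[case/orP]; move=> /eqP[] // -> ->.
Qed.

Lemma pappus_arc_to_w i y :
  arc y (pw i) = [|| y == pu (i - j%:R), y == pu (i + j%:R) | y == pw (i - k%:R)].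
Proof.
apply/existsP/or3P => [[x]|[]/eqP->]; last 3 first.
- by exists (i - j%:R); rewrite subrK eqxx !orbT.
- by exists (i + j%:R); rewrite addrK eqxx !orbT.
- by exists (i - k%:R); rewrite subrK eqxx !orbT.
by do 4?[case/orP]; move=> /eqP[] // -> ->; rewrite ?addrK ?subrK;
  [constructor 1 | constructor 2 | constructor 3].
Qed.

Local Notation G := (pappus m j k).

(** Only membership is compared: for small [m] the entries may coincide, so distinctness is
    established separately. Loops are excluded because 1 is nonzero in ['Z_m]. *)
Lemma open_nbh_v i :
  open_nbh (pv i : G) =i [:: pv (i - 1); pv (i + 1); pu i].
Proof.
move=> y; rewrite !inE /= /pappus_adj pappus_arc_v pappus_arc_to_v.
rewrite orbC andb_idl // => /or3P[] /eqP->; apply/eqP => // -[] /eqP.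
- by rewrite -subr_eq0 opprB addrC subrK oner_eq0.
- by rewrite -subr_eq0 opprD addNKr oppr_eq0 oner_eq0.
Qed.

Lemma open_nbh_u i :
  open_nbh (pu i : G) =i [:: pw (i - j%:R); pw (i + j%:R); pv i].
Proof.
move=> y; rewrite !inE /= /pappus_adj pappus_arc_u pappus_arc_to_u.
rewrite andb_idl => [|]; first by rewrite -orbA orbCA.
by case/orP=> [/orP[]|] /eqP->; apply/eqP.
Qed.

Lemma open_nbh_w i : k%:R != 0 :> 'Z_m ->
  open_nbh (pw i : G) =i
    [:: pu (i - j%:R); pu (i + j%:R); pw (i + k%:R); pw (i - k%:R)].
Proof.
move=> k0 y; rewrite !inE /= /pappus_adj pappus_arc_w pappus_arc_to_w.
rewrite andb_idl => [|]; first by rewrite orbCA; congr (_ || _); rewrite orbCA.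
case/orP=> [|/or3P[]] /eqP->; apply/eqP => // -[] /eqP.
- by rewrite -subr_eq0 opprD addNKr oppr_eq0 (negPf k0).
- by rewrite -subr_eq0 opprB addrC subrK (negPf k0).
Qed.

End Neighbourhoods.

(** * Counting colours in a neighbourhood *)

Definition color_count (G : sgraph) (l : G -> 'Z_3) (s : seq G) a :=
  count (fun y => l y == a) s.

Lemma card_color_nbh (G : sgraph) (l : G -> 'Z_3) x (s : seq G) a :
    uniq s -> open_nbh x =i s ->
  #|[set y in open_nbh x | l y == a]| = color_count l s a.
Proof.
move=> s_uniq xs; rewrite /color_count -size_filter.
rewrite -(card_uniqP (filter_uniq _ s_uniq)).
by apply: eq_card => y; rewrite inE mem_filter xs andbC.
Qed.

Lemma sum_color_count (G : sgraph) (l : G -> 'Z_3) (s : seq G) :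
  \sum_a color_count l s a = size s.
Proof.
elim: s => [|x s IHs] /=; first by rewrite big1.
rewrite big_split /= IHs (bigD1 (l x)) //= eqxx big1 ?addn0 // => a.
by rewrite eq_sym => /negPf->.
Qed.

(** The three colour counts are equal and add up to the length of the list. *)
Lemma size_balanced (G : sgraph) (l : G -> 'Z_3) (s : seq G) :
    (forall a b, color_count l s a = color_count l s b) ->
  size s = (3 * color_count l s 0%R)%N.
Proof.
move=> bal; rewrite -(sum_color_count l) (eq_bigr (fun=> color_count l s 0)) //.
by rewrite sum_nat_const card_ord.
Qed.

Lemma uniq_color_count (G : sgraph) (l : G -> 'Z_3) (s : seq G) a :
  size s = 3 -> uniq (map l s) -> color_count l s a = 1%N.
Proof.
move=> s3 ls_uniq; rewrite /color_count -(count_map l (pred1 a)) count_uniq_mem //.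
have sub x : x \in map l s -> x \in enum 'Z_3 by rewrite mem_enum.
have [|_ ->] := uniq_min_size ls_uniq sub; last by rewrite mem_enum.
by rewrite (size_map l) s3 size_enum_ord.
Qed.

(** * Discrete Fourier transform on ['Z_m] *)

(** Exponents are representatives below [m]; the wrap-around in [x + y] is absorbed by
    [z ^+ m = 1]. *)
Lemma expr_ZpD (R : nzRingType) m (z : R) (x y : 'Z_m) : (1 < m)%N -> z ^+ m = 1 ->
  z ^+ (x + y)%R = z ^+ x * z ^+ y.
Proof.
move=> m_gt1 zm; rewrite -exprD -(expr_mod (x + y) zm); congr (z ^+ (_ %% _)).
exact: Zp_cast.
Qed.

Section Fourier.

Variables (m : nat) (z : algC).
Hypotheses (m_gt1 : (1 < m)%N) (zm : z ^+ m = 1).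

Definition fourier (F : 'Z_m -> algC) := \sum_i F i * z ^+ i.

Lemma fourierD F1 F2 : fourier (fun i => F1 i + F2 i) = fourier F1 + fourier F2.
Proof. by rewrite -big_split; apply: eq_bigr => i _; rewrite mulrDl. Qed.

Lemma fourier_shiftB F n : fourier (fun i => F (i - n%:R)) = z ^+ n * fourier F.
Proof.
rewrite /fourier mulr_sumr (reindex_inj (addIr n%:R)) /=.
apply: eq_bigr => i _; rewrite addrK expr_ZpD // val_Zp_nat // expr_mod //; ring.
Qed.

Lemma fourier_shiftD F n : fourier (fun i => F (i + n%:R)) = z ^- n * fourier F.
Proof.
have zn0 : z ^+ n != 0.
  rewrite expf_neq0 //; apply: contra_eq_neq zm => ->.
  by rewrite expr0n gtn_eqF ?(ltnW m_gt1) // eq_sym oner_eq0.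
apply: (mulfI zn0); rewrite mulVKf // -fourier_shiftB.
by apply: eq_bigr => i _; rewrite subrK.
Qed.

End Fourier.

Lemma sum_expr_unity_root d (z : algC) : z ^+ d = 1 ->
  \sum_(t < d) z ^+ t = (z == 1)%:R * d%:R.
Proof.
move=> zd; have [->|z1] := eqVneq z 1.
  rewrite mul1r (eq_bigr (fun=> 1)) ?sumr_const ?card_ord // => t _.
  by rewrite expr1n.
have /mulfI zI : z - 1 != 0 by rewrite subr_eq0.
by apply: zI; rewrite -subrX1 zd subrr mul0r mulr0.
Qed.

(** Orthogonality of characters: after exchanging the sums, the inner geometric sum is [d] if [d]
    divides [i] and 0 otherwise. *)
Lemma sum_fourier d m (w : algC) (F : 'Z_m -> algC) : (0 < d)%N ->
    d.-primitive_root w ->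
  \sum_(t < d) fourier (w ^+ t) F = d%:R * \sum_(i | (d %| (i : 'Z_m))%N) F i.
Proof.
move=> d_gt0 wd; rewrite exchange_big [in RHS]big_mkcond mulr_sumr.
apply: eq_bigr => i _; rewrite -mulr_sumr.
under eq_bigr => t _ do rewrite exprAC.
rewrite sum_expr_unity_root; last by rewrite exprAC (prim_expr_order wd) expr1n.
rewrite -(prim_order_dvd wd); case: ifP => _; first by rewrite mul1r mulrC.
by rewrite mul0r !mulr0.
Qed.

Lemma sum_Zp_dvdn d m : (1 < m)%N -> (d %| m)%N ->
  (\sum_(i : 'Z_m) (d %| i) = m %/ d)%N.
Proof.
move=> m_gt1 dm; rewrite divn_count_dvd.
rewrite -(big_mkord xpredT (fun i => (d %| i : nat)%N)) /= Zp_cast //.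
case: m m_gt1 dm => // m m_gt1 dm.
(* The count over 1..m becomes one over 0..m-1, as [d] divides both 0 and [m]. *)
by rewrite big_nat_recl // big_add1 /= big_nat_recr //= dvdn0 dm addnC.
Qed.

(** * Fourier obstruction for a single colour class *)

Section Obstruction.

Variables (m j k : nat) (a b c : 'Z_m -> bool).
Hypotheses (m_gt1 : (1 < m)%N) (def_m : (2 * k = m)%N).
Hypothesis abP : forall i, (a (i - 1)%R + a (i + 1)%R + b i = 1)%N.
Hypothesis caP : forall i, (c (i - j%:R)%R + c (i + j%:R)%R + a i = 1)%N.
Hypothesis bcP : forall i, (b (i - j%:R)%R + b (i + j%:R)%R + c (i + k%:R)%R = 1)%N.

(** This normalisation makes the three local conditions homogeneous, so their transforms carry no
    constant term. *)
Let dev (f : 'Z_m -> bool) (i : 'Z_m) : algC := 3%:R * (f i)%:R - 1.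

Lemma dev_sum0 (x y z : bool) : (x + y + z = 1)%N ->
  (3%:R * x%:R - 1) + (3%:R * y%:R - 1) + (3%:R * z%:R - 1) = 0 :> algC.
Proof.
move=> xyz; have -> : (3%:R * x%:R - 1) + (3%:R * y%:R - 1) + (3%:R * z%:R - 1) =
  3%:R * (x + y + z)%N%:R - 3%:R :> algC by rewrite !natrD; ring.
by rewrite xyz mulr1 subrr.
Qed.

Lemma fourier_dev_eq0 (z : algC) : z ^+ m = 1 -> z ^+ k = 1 ->
  (z ^+ j + z ^- j) ^+ 2 * (z + z^-1) + 1 != 0 -> fourier z (dev a) = 0.
Proof.
move=> zm zk P0; have shiftB := fourier_shiftB m_gt1 zm.
have shiftD := fourier_shiftD m_gt1 zm.
have sum0 f1 f2 f3 : (forall i, f1 i + f2 i + f3 i = 0) ->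
    fourier z f1 + fourier z f2 + fourier z f3 = 0 :> algC.
  move=> f0; rewrite -!fourierD /fourier big1 // => i _.
  by rewrite f0 mul0r.
have /sum0 := fun i => dev_sum0 (abP i).
have /sum0 := fun i => dev_sum0 (caP i).
have /sum0 := fun i => dev_sum0 (bcP i).
rewrite !(shiftB (dev a) 1%N, shiftD (dev a) 1%N, shiftB (dev b), shiftD (dev b),
  shiftB (dev c), shiftD (dev c)).
rewrite zk invr1 mul1r expr1.
set B := fourier z (dev b); set C := fourier z (dev c).
set A := fourier z _ => eC eA eB.
pose y := z ^+ j + z ^- j.
apply: (mulfI P0); rewrite mulr0.
(* Elimination: B = -(z + z^-1) A and C = -y B are substituted into y C + A = 0, written as one
   linear combination. *)
have -> : (y ^+ 2 * (z + z^-1) + 1) * A =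
    y ^+ 2 * (z * A + z^-1 * A + B) - y * (z ^+ j * B + z ^- j * B + C) +
    (z ^+ j * C + z ^- j * C + A) by rewrite /y; ring.
by rewrite eA eB eC !mulr0 subrr addr0.
Qed.

Lemma pappus_obstruction : (3 %| m)%N && ~~ (3 %| j)%N.
Proof.
apply: contraT; rewrite negb_and negbK => dvd_j.
have m_gt0 : (0 < m)%N by apply: ltnW.
pose t := logn 3 m; pose d := (3 ^ t)%N.
have d_gt0 : (0 < d)%N by rewrite expn_gt0.
have dm : (d %| m)%N by rewrite pfactor_dvdnn.
(* [d] is odd and divides 2k, so every d-th root of unity also satisfies z^k = 1. *)
have dk : (d %| k)%N.
  have d2 : coprime d 2 by rewrite coprimeXl.
  by rewrite -(Gauss_dvdr _ d2) def_m.
have [w wd] := C_prim_root_exists d_gt0.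
have sum0 : d%:R * \sum_(i | (d %| (i : 'Z_m))%N) dev a i = 0.
  rewrite -(sum_fourier _ d_gt0 wd) big1 // => s _.
  have ws_d : (w ^+ s) ^+ d = 1 by rewrite exprAC (prim_expr_order wd) expr1n.
  have ws1 n : (d %| n)%N -> (w ^+ s) ^+ n = 1.
    by case/dvdnP=> q ->; rewrite mulnC exprM ws_d expr1n.
  apply: fourier_dev_eq0; [exact: ws1 | exact: ws1 |].
  (* If 3 does not divide [m], then t = 0 and the side condition is vacuous; otherwise [dvd_j] gives
     3 | j. *)
  apply: (pappus_root_neq0 ws_d); rewrite logn_gt0 mem_primes m_gt0 /= => dvd_m.
  by move: dvd_j; rewrite dvd_m.
have {}sum0 : (3 * \sum_(i : 'Z_m | d %| i) a i = m %/ d)%N.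
  have -> : (m %/ d = \sum_(i : 'Z_m | d %| i) 1)%N.
    rewrite -(sum_Zp_dvdn m_gt1 dm) [RHS]big_mkcond.
    by apply: eq_bigr => i _; case: (d %| i)%N.
  apply/eqP; rewrite -(eqr_nat algC) -subr_eq0.
  move/eqP: sum0; rewrite mulf_eq0 pnatr_eq0 eqn0Ngt d_gt0 /= sumrB -mulr_sumr.
  by rewrite natrM !natr_sum.
(* This contradicts the choice of [d] as the full 3-part of [m]. *)
have : (3 * d %| m)%N by rewrite -(divnK dm) -sum0 dvdn_pmul2r // dvdn_mulr.
by rewrite -expnS pfactor_dvdn // ltnn.
Qed.

End Obstruction.

(** * Distinct neighbours, and the neighbourhoods of w_i when 2k = m *)

Lemma addBr_neqD (V : zmodType) (x y : V) : y + y != 0 -> x - y != x + y.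
Proof.
apply: contraNneq => xy; rewrite -(subrr (x + y)) -{2}xy opprB [x + y]addrC.
by rewrite addrACA subrr addr0.
Qed.

Lemma pv_inj m : injective (@pv m).
Proof. by move=> x y []. Qed.

Lemma pu_inj m : injective (@pu m).
Proof. by move=> x y []. Qed.

Lemma pw_inj m : injective (@pw m).
Proof. by move=> x y []. Qed.

Lemma size_balanced_nbh (G : sgraph) (l : G -> 'Z_3) x (s : seq G) :
    (forall a b, #|[set y in open_nbh x | l y == a]| =
                 #|[set y in open_nbh x | l y == b]|) ->
    uniq s -> open_nbh x =i s -> size s = (3 * color_count l s 0%R)%N.
Proof.
move=> bal s_uniq xs; apply: size_balanced => a b.
by rewrite -!(card_color_nbh _ _ s_uniq xs).
Qed.

Lemma open_nbh_w_half m j k i : k%:R != 0 :> 'Z_m -> (k + k)%:R = 0 :> 'Z_m ->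
  open_nbh (pw i : pappus m j k) =i
    [:: pu (i - j%:R); pu (i + j%:R); pw (i + k%:R)].
Proof.
move=> k0 kk0 y; rewrite open_nbh_w // !inE.
have -> : i - k%:R = i + k%:R; last by rewrite orbb.
by apply/eqP; rewrite -subr_eq0 opprD addrACA subrr add0r -opprD -natrD kk0 oppr0.
Qed.

(** * Reduction modulo 3 *)

(** Reduction goes through the representative below [m]; it is additive once 3 divides [m] > 1. *)
Definition Zp_mod3 m (x : 'Z_m) : 'Z_3 := (x : nat)%:R.

Lemma natr_Zp_mod p n : (1 < p)%N -> (n %% p)%:R = n%:R :> 'Z_p.
Proof. by move=> p_gt1; apply/val_inj; rewrite /= !val_Zp_nat // modn_mod. Qed.

Section Mod3.

Variable m : nat.
Hypotheses (m_gt1 : (1 < m)%N) (dvd3m : (3 %| m)%N).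

Lemma Zp_mod3_nat n : Zp_mod3 (n%:R : 'Z_m) = n%:R.
Proof.
rewrite /Zp_mod3 val_Zp_nat // -(@natr_Zp_mod 3) // modn_dvdm //.
exact: natr_Zp_mod.
Qed.

Lemma Zp_mod3D (x y : 'Z_m) : Zp_mod3 (x + y) = Zp_mod3 x + Zp_mod3 y.
Proof.
by rewrite -{1}[x]natr_Zp -{1}[y]natr_Zp -natrD Zp_mod3_nat natrD.
Qed.

Lemma Zp_mod3B (x y : 'Z_m) : Zp_mod3 (x - y) = Zp_mod3 x - Zp_mod3 y.
Proof. by apply: (addIr (Zp_mod3 y)); rewrite -Zp_mod3D !subrK. Qed.

End Mod3.

(** A nonzero [y] generates ['Z_3]. In the colouring by index modulo 3 these are the colours around
    a vertex of index [x], with [y] equal to 1 or [j]. *)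
Lemma uniq_Z3 (x y : 'Z_3) : y != 0 -> uniq [:: x - y; x + y; x].
Proof. by case: x y => [[|[|[|//]]] ?] [[|[|[|//]]] ?]. Qed.

(* The two directions of the equivalence *)
Close Scope ring_scope.

Theorem theorem5p6 (m j k : nat) (hm : 4 <= m)
    (hj : 1 <= j) (hjm : 2 * j < m) (hk : 1 <= k) (hkm : 2 * k <= m) :
  three_balanced (pappus m j k) <-> [/\ 6 %| m, ~~ (3 %| j) & 2 * k = m].
Proof.
have m_gt1 : 1 < m by apply: leq_trans hm.
have nat0 n : 0 < n < m -> (n%:R != 0 :> 'Z_m)%R.
  by case/andP=> n_gt0 ?; rewrite natr_Zp_eq0 // gtnNdvd.
have k0 : (k%:R != 0 :> 'Z_m)%R by apply: nat0; lia.
have jj i : (i - j%:R != i + j%:R :> 'Z_m)%R.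
  by apply: addBr_neqD; rewrite -natrD nat0 //; lia.
have v_uniq i : uniq [:: pv (i - 1) : pappus m j k; pv (i + 1); pu i]%R.
  have /= v12 : (i - 1 != i + 1)%R.
    by apply: addBr_neqD; rewrite -(natrD _ 1 1) nat0 //; lia.
  by rewrite /= !inE !orbF andbT; apply: contraNneq v12 => /pv_inj->.
have u_uniq i : uniq [:: pw (i - j%:R) : pappus m j k; pw (i + j%:R); pv i]%R.
  by rewrite /= !inE !orbF andbT; apply: contraNneq (jj i) => /pw_inj->.
have w_uniq i x : uniq [:: pu (i - j%:R) : pappus m j k; pu (i + j%:R); pw x]%R.
  by rewrite /= !inE !orbF andbT; apply: contraNneq (jj i) => /pu_inj->.
split=> [[l bal] | [dvd6m ndvd_j def_m]].
  have def_m : 2 * k = m.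
    apply/eqP; rewrite eqn_leq hkm leqNgt; apply/negP => lt_m.
    (* If 2k < m, the vertex w_0 has four distinct neighbours, and 4 is not a multiple of 3. *)
    have w4_uniq : uniq [:: pu (0 - j%:R) : pappus m j k; pu (0 + j%:R);
                             pw (0 + k%:R); pw (0 - k%:R)]%R.
      rewrite (cat_uniq [:: _; _; _] [:: _]) w_uniq /= !inE /= orbF andbT.
      have kk : (0 - k%:R != 0 + k%:R :> 'Z_m)%R.
        by apply: addBr_neqD; rewrite -natrD nat0 //; lia.
      by apply: contraNneq kk => /pw_inj->.
    have four c : 4 <> 3 * c by lia.
    have /four// := size_balanced_nbh (bal _) w4_uniq (@open_nbh_w m j k 0%R k0).
  have kk0 : ((k + k)%:R = 0 :> 'Z_m)%R.
    by apply/eqP; rewrite natr_Zp_eq0 // addnn -mul2n def_m.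
  (* Every neighbourhood now has three vertices, so colour 0 occurs in each exactly once; the
     obstruction is applied to that class. *)
  have one (c : nat) : 3 = 3 * c -> c = 1 by lia.
  have /andP[dvd3m ndvd_j] : (3 %| m) && ~~ (3 %| j).
    apply: (@pappus_obstruction m j k (fun i => l (pv i) == 0%R)
              (fun i => l (pu i) == 0%R) (fun i => l (pw i) == 0%R)) => // i.
    - have /one := size_balanced_nbh (bal _) (v_uniq i) (@open_nbh_v m j k i).
      by rewrite /color_count /= addn0 addnA.
    - have /one := size_balanced_nbh (bal _) (u_uniq i) (@open_nbh_u m j k i).
      by rewrite /color_count /= addn0 addnA.
    - have /one := size_balanced_nbh (bal _) (w_uniq i _)
        (@open_nbh_w_half m j k i k0 kk0).
      by rewrite /color_count /= addn0 addnA.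
  by split=> //; rewrite (@Gauss_dvd 2 3) // dvd3m -def_m dvdn_mulr.
have dvd3m : 3 %| m by apply: dvdn_trans dvd6m.
have kk0 : ((k + k)%:R = 0 :> 'Z_m)%R.
  by apply/eqP; rewrite natr_Zp_eq0 // addnn -mul2n def_m.
(* From 3 | 2k follows 3 | k, so w_(i+k) has the colour of w_i. *)
have k3 : (k%:R = 0 :> 'Z_3)%R.
  by apply/eqP; rewrite natr_Zp_eq0 // -(@Gauss_dvdr 3 2) // def_m.
have j3 : (j%:R != 0 :> 'Z_3)%R by rewrite natr_Zp_eq0.
pose l (x : pappus m j k) : 'Z_3 :=
  match x with inl (inl i) | inl (inr i) | inr i => Zp_mod3 i end.
have bal_at x s : size s = 3 -> uniq (map l s) -> open_nbh x =i s ->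
    forall a b, #|[set y in open_nbh x | l y == a]| =
                #|[set y in open_nbh x | l y == b]|.
  move=> s3 ls_uniq xs a b; rewrite !(card_color_nbh _ _ (map_uniq ls_uniq) xs).
  by rewrite !uniq_color_count.
exists l => -[[i|i]|i].
- apply: (bal_at (pv i) _ _ _ (@open_nbh_v m j k i)) => //.
  rewrite /= Zp_mod3B // Zp_mod3D // (Zp_mod3_nat m_gt1 dvd3m 1).
  exact: uniq_Z3.
- apply: (bal_at (pu i) _ _ _ (@open_nbh_u m j k i)) => //.
  rewrite /= Zp_mod3B // Zp_mod3D // Zp_mod3_nat //.
  exact: uniq_Z3.
- apply: (bal_at (pw i) _ _ _ (@open_nbh_w_half m j k i k0 kk0)) => //.
  rewrite /= Zp_mod3B // !Zp_mod3D // !Zp_mod3_nat // k3 addr0.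
  exact: uniq_Z3.
Qed.
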